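(* Let $A_1B_1C_1$, $A_2B_2C_2$, $A_3B_3C_3$ be three triangles in a plane that are pairwise homological (with the vertex correspondence $A_i\leftrightarrow A_j$, $B_i\leftrightarrow B_j$, $C_i\leftrightarrow C_j$) and whose three homological axes coincide. Then their three homological centers (of the pairs $(1,2)$, $(2,3)$, $(1,3)$) are collinear.
   Context: Work in the real plane completed with its points at infinity (the real projective plane). Two (non-degenerate) triangles $ABC$ and $A'B'C'$, with vertex correspondence $A\leftrightarrow A'$, $B\leftrightarrow B'$, $C\leftrightarrow C'$, corresponding vertices distinct and corresponding side lines distinct, are called homological (perspective) if the lines $AA'$, $BB'$, $CC'$ pass through a common point, called the homological center. By Desargues' theorem the points $BC\cap B'C'$, $CA\cap C'A'$, $AB\cap A'B'$ are then collinear, and the line containing them is called the homological axis. *)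

(* Defs.v *)
(* The real projective plane is P(R^3): its points are the 1-dimensional
   subspaces of R^3 and its lines the 2-dimensional ones, a point lying on a
   line when it is contained in it.  The ordinary point (x, y) is the span of
   (x, y, 1); the points at infinity are the spans of the nonzero (x, y, 0). *)
From HB Require Import structures.
From mathcomp Require Import all_boot all_order all_algebra.
From mathcomp Require Import reals.

Set Implicit Arguments.
Unset Strict Implicit.
Unset Printing Implicit Defensive.

Import Order.TTheory GRing.Theory Num.Theory.
Local Open Scope ring_scope.

Record point (R : realType) := Point {
  point_space :> {vspace 'rV[R]_3};
  point_dim : \dim point_space == 1%N }.

HB.instance Definition _ (R : realType) := [isSub for @point_space R].
HB.instance Definition _ (R : realType) := [Choice of point R by <:].

Record line (R : realType) := Line {
  line_space :> {vspace 'rV[R]_3};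
  line_dim : \dim line_space == 2%N }.

HB.instance Definition _ (R : realType) := [isSub for @line_space R].
HB.instance Definition _ (R : realType) := [Choice of line R by <:].

(* A genuine line only for P != Q, see dim_join. *)
Definition join (R : realType) (P Q : point R) : {vspace 'rV[R]_3} :=
  (P + Q)%VS.

(* For subspaces of dimension 2, a genuine point only for U != V, see
   dim_meet. *)
Definition meet (R : realType) (U V : {vspace 'rV[R]_3}) : {vspace 'rV[R]_3} :=
  (U :&: V)%VS.

Definition collinear (R : realType) (P Q S : point R) : Prop :=
  exists l : line R, [/\ (P <= l)%VS, (Q <= l)%VS & (S <= l)%VS].

Record triangle (R : realType) := Triangle {
  vA : point R;
  vB : point R;
  vC : point R;
  triangle_nondegenerate : ~ collinear vA vB vC }.

Definition sideA (R : realType) (T : triangle R) := join (vB T) (vC T).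
Definition sideB (R : realType) (T : triangle R) := join (vC T) (vA T).
Definition sideC (R : realType) (T : triangle R) := join (vA T) (vB T).

(* For homological triangles the center and the axis below are unique: the
   lines AA' and BB' differ since AB <> A'B', and the three intersection points
   of corresponding sides are not all equal since BC, CA, AB are not
   concurrent. *)
Definition homological_center (R : realType) (T T' : triangle R)
    (O : point R) : Prop :=
  [/\ (O <= join (vA T) (vA T'))%VS,
      (O <= join (vB T) (vB T'))%VS
    & (O <= join (vC T) (vC T'))%VS].

Definition homological (R : realType) (T T' : triangle R) : Prop :=
  [/\ [/\ vA T <> vA T', vB T <> vB T' & vC T <> vC T'],
      [/\ sideA T <> sideA T', sideB T <> sideB T' & sideC T <> sideC T']
    & exists O : point R, homological_center T T' O].

Definition homological_axis (R : realType) (T T' : triangle R)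
    (l : line R) : Prop :=
  [/\ (meet (sideA T) (sideA T') <= l)%VS,
      (meet (sideB T) (sideB T') <= l)%VS
    & (meet (sideC T) (sideC T') <= l)%VS].

Lemma dim_join (R : realType) (P Q : point R) :
  P <> Q -> \dim (join P Q) = 2%N.
Proof.
move=> neqPQ; have dP := eqP (point_dim P); have dQ := eqP (point_dim Q).
rewrite /join dimv_disjoint_sum ?dP ?dQ //; apply/eqP.
rewrite -dimv_eq0 -leqn0 leqNgt; apply/negP => dI; case: neqPQ.
apply/val_inj/eqP => /=.
have eP : (P :&: Q)%VS = P.
  by apply/eqP; rewrite eqEdim capvSl dP.
by rewrite eqEdim dP dQ leqnn andbT -eP capvSr.
Qed.

Lemma dim_meet (R : realType) (U V : {vspace 'rV[R]_3}) :
  \dim U = 2%N -> \dim V = 2%N -> U <> V -> \dim (meet U V) = 1%N.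
Proof.
move=> dU dV neqUV; rewrite /meet.
have := dimv_sum_cap U V; rewrite dU dV => e.
have s3 : (\dim (U + V) <= 3)%N.
  by apply: leq_trans (dimvS (subvf _)) _; rewrite dimvf /dim /= mul1n.
have s2 : (2 < \dim (U + V))%N.
  rewrite ltnNge; apply/negP => le2; case: neqUV.
  have eU : U = (U + V)%VS by apply/eqP; rewrite eqEdim addvSl dU.
  by rewrite eU; apply/esym/eqP; rewrite eqEdim addvSr dV.
have s : \dim (U + V) = 3%N by apply/eqP; rewrite eqn_leq s3 s2.
by apply: (@addnI 3); rewrite -[X in (X + _)%N = _]s e.
Qed.

(* Main.v *)
(* Only the sides AB matter.  Three distinct lines whose pairwise intersections
   lie on a common line l are concurrent, so some vector r <> 0 lies on the
   three lines A_i B_i.  Write r = u_i + v_i with u_i in A_i and v_i in B_i.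
   Then d_ij := u_i - u_j = v_j - v_i is a nonzero vector of the intersection
   of A_i A_j and B_i B_j, so it spans O_ij; and d_12 + d_23 = d_13. *)
Require Import Defs.
From mathcomp Require Import all_boot all_order all_algebra.
From mathcomp Require Import reals.

Set Implicit Arguments.
Unset Strict Implicit.
Unset Printing Implicit Defensive.

Import GRing.Theory.
Local Open Scope ring_scope.

Lemma distinct_points_cap (R : realType) (P Q : point R) :
  P <> Q -> (P :&: Q)%VS = 0%VS.
Proof.
move=> /dim_join dPQ; apply/eqP; rewrite -dimv_eq0.
have := dimv_sum_cap P Q.
rewrite (eqP (point_dim P)) (eqP (point_dim Q)) -[(P + Q)%VS]/(join P Q) dPQ.
by case: (\dim _).
Qed.

Lemma point_sub_dim1 (R : realType) (P : point R) (U : {vspace 'rV[R]_3}) d :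
  \dim U = 1%N -> (P <= U)%VS -> d \in U -> d != 0 -> P = <[d]>%VS :> {vspace _}.
Proof.
move=> dU sPU Ud d0.
have -> : P = U :> {vspace _}.
  by apply/eqP; rewrite eqEdim sPU dU (eqP (point_dim P)).
by apply/esym/eqP; rewrite eqEdim -memvE Ud dU dim_vline d0.
Qed.

Lemma collinear_join (R : realType) (P Q S : point R) :
  P <> Q -> (S <= join P Q)%VS -> collinear P Q S.
Proof.
move=> neqPQ sS; exists (Line (introT eqP (dim_join neqPQ))).
by split=> //=; rewrite ?addvSl ?addvSr.
Qed.

Lemma exists_distinct_point (R : realType) (P : point R) :
  exists Q : point R, P <> Q.
Proof.
(* The second point is spanned by a nonzero vector of a complement of [P]: the complement has
   dimension 2 and meets [P] only in 0. *)
have d0 : vpick P^C%VS != 0.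
  by rewrite vpick0 -dimv_eq0 dimv_compl (eqP (point_dim P)) dimvf.
have d1 : \dim <[vpick P^C%VS]>%VS == 1%N by rewrite dim_vline d0.
exists (Point d1) => /(congr1 (@point_space R)) /= eP.
have : vpick P^C%VS \in (P :&: P^C)%VS.
  by rewrite memv_cap memv_pick andbT memvE -eP subvv.
by rewrite capv_compl memv0; apply/negP.
Qed.

(** This serves the degenerate cases: [collinear] asks for an actual line, which [join P P] is not.
    When all the points coincide, an auxiliary second point supplies the line. *)
Lemma collinear_diag (R : realType) (P Q : point R) : collinear P P Q.
Proof.
have [<- | /eqP nPQ] := eqVneq P Q.
  have [S nPS] := exists_distinct_point P.
  by have [l [Pl _ _]] := collinear_join nPS (addvSl _ _); exists l.
by have [l [Pl Ql _]] := collinear_join nPQ (addvSl _ _); exists l.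
Qed.

Lemma triangle_neqAB (R : realType) (T : triangle R) : vA T <> vB T.
Proof.
move=> eAB; apply: (@triangle_nondegenerate R T).
by rewrite -eAB; apply: collinear_diag.
Qed.

(** If [m1] meets [m2] and [m3] in the same point, that point is common to all three. Otherwise
    these two distinct points lie on both [m1] and [l], so [m1 = l], and the intersection of [m2]
    and [m3], being on [l], is on [m1] as well. *)
Lemma concurrent_of_meets_on_line (R : realType)
    (l m1 m2 m3 : {vspace 'rV[R]_3}) :
    \dim l = 2%N -> \dim m1 = 2%N -> \dim m2 = 2%N -> \dim m3 = 2%N ->
    m1 <> m2 -> m1 <> m3 -> m2 <> m3 ->
    (meet m1 m2 <= l)%VS -> (meet m1 m3 <= l)%VS -> (meet m2 m3 <= l)%VS ->
  exists r, [/\ r != 0, r \in m1, r \in m2 & r \in m3].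
Proof.
move=> dl d1 d2 d3 n12 n13 n23 s12 s13 s23.
have d12 := dim_meet d1 d2 n12; have d13 := dim_meet d1 d3 n13.
have d23 := dim_meet d2 d3 n23.
have pick0 (U : {vspace 'rV[R]_3}) : \dim U = 1%N -> vpick U != 0.
  by move=> dU; rewrite vpick0 -dimv_eq0 dU.
have [e | ne] := eqVneq (meet m1 m2) (meet m1 m3).
  exists (vpick (meet m1 m2)); have := memv_pick (meet m1 m2).
  rewrite {2}e /meet => r2; have := memv_pick (meet m1 m2).
  by move: r2; rewrite !memv_cap => /andP[-> ->] /andP[_ ->]; rewrite pick0.
pose P12 := Point (introT eqP d12); pose P13 := Point (introT eqP d13).
have dP : \dim (join P12 P13) = 2%N.
  by apply: dim_join => /(congr1 (@point_space R))/eqP; apply/negP.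
have e1 : join P12 P13 = m1.
  by apply/eqP; rewrite eqEdim d1 dP leqnn andbT subv_add !capvSl.
have el : join P12 P13 = l.
  by apply/eqP; rewrite eqEdim dl dP leqnn andbT subv_add s12 s13.
have r23 := memv_pick (meet m2 m3).
exists (vpick (meet m2 m3)); split; first exact: pick0.
- by rewrite -e1 el (subvP s23).
- by move: r23; rewrite memv_cap => /andP[].
- by move: r23; rewrite memv_cap => /andP[].
Qed.

Lemma intersection_vector (R : realType) (A A' B B' O : point R)
    (u u' v v' r : 'rV[R]_3) :
    A <> A' -> B <> B' -> A <> B -> A' <> B' -> join A B <> join A' B' ->
    (O <= join A A')%VS -> (O <= join B B')%VS ->
    u \in (A : {vspace _}) -> u' \in (A' : {vspace _}) ->
    v \in (B : {vspace _}) -> v' \in (B' : {vspace _}) ->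
    r != 0 -> r = u + v -> r = u' + v' ->
  O = <[u - u']>%VS :> {vspace _}.
Proof.
move=> nA nB nAB nAB' nl sOA sOB Au Au' Bv Bv' r0 ruv ruv'.
(* If the two lines coincided, they would contain all four points, so [join A B] and [join A' B']
   would both equal that line, against [nl]. *)
have neq : join A A' <> join B B'.
  move=> e; apply: nl.
  have sub (C D : point R) :
      C <> D -> (C <= join A A')%VS -> (D <= join A A')%VS ->
      join C D = join A A'.
    move=> nCD sC sD; apply/eqP.
    by rewrite eqEdim (dim_join nCD) (dim_join nA) subv_add sC sD.
  by rewrite !sub // ?addvSl ?addvSr // e ?addvSl ?addvSr.
have euv : u - u' = v' - v.
  by apply/eqP; rewrite subr_eq addrAC eq_sym subr_eq addrC -ruv' ruv.
apply: point_sub_dim1 (dim_meet (dim_join nA) (dim_join nB) neq) _ _ _.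
- by rewrite subv_cap sOA.
- rewrite memv_cap; apply/andP; split; first by rewrite memv_add ?memvN.
  by rewrite euv addrC memv_add ?memvN.
(* If [u = u'], then also [v = v'] by [euv]. Distinct points share only the zero vector, so [u] and
   [v] both vanish and [r = 0]. *)
apply: contraNneq r0 => d0; rewrite ruv.
have u0 : u \in (A :&: A')%VS by rewrite memv_cap Au (subr0_eq d0).
have v0 : v \in (B :&: B')%VS.
  by rewrite memv_cap Bv -(subr0_eq (etrans (esym euv) d0)).
move: u0 v0; rewrite !distinct_points_cap // !memv0 => /eqP-> /eqP->.
by rewrite addr0.
Qed.

Theorem theorem2 (R : realType) (T1 T2 T3 : triangle R)
    (h12 : homological T1 T2) (h23 : homological T2 T3)
    (h13 : homological T1 T3)
    (l : line R)
    (l12 : homological_axis T1 T2 l) (l23 : homological_axis T2 T3 l)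
    (l13 : homological_axis T1 T3 l)
    (O12 O23 O13 : point R)
    (hO12 : homological_center T1 T2 O12)
    (hO23 : homological_center T2 T3 O23)
    (hO13 : homological_center T1 T3 O13) :
  collinear O12 O23 O13.
Proof.
have nAB := @triangle_neqAB R.
have [[A12 B12 _] [_ _ C12] _] := h12; have [[A23 B23 _] [_ _ C23] _] := h23.
have [[A13 B13 _] [_ _ C13] _] := h13.
have [_ _ s12] := l12; have [_ _ s23] := l23; have [_ _ s13] := l13.
have [a12 b12 _] := hO12; have [a23 b23 _] := hO23; have [a13 b13 _] := hO13.
have dC (T : triangle R) : \dim (sideC T) = 2%N := dim_join (nAB T).
have [r [r0]] := concurrent_of_meets_on_line (eqP (line_dim l))
  (dC T1) (dC T2) (dC T3) C12 C13 C23 s12 s13 s23.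
move=> /memv_addP[u1 Au1 [v1 Bv1 r1]] /memv_addP[u2 Au2 [v2 Bv2 r2]].
move=> /memv_addP[u3 Au3 [v3 Bv3 r3]].
have e12 := intersection_vector A12 B12 (nAB T1) (nAB T2) C12 a12 b12
  Au1 Au2 Bv1 Bv2 r0 r1 r2.
have e23 := intersection_vector A23 B23 (nAB T2) (nAB T3) C23 a23 b23
  Au2 Au3 Bv2 Bv3 r0 r2 r3.
have e13 := intersection_vector A13 B13 (nAB T1) (nAB T3) C13 a13 b13
  Au1 Au3 Bv1 Bv3 r0 r1 r3.
have sO13 : (O13 <= join O12 O23)%VS.
  rewrite /join e12 e23 e13 -memvE.
  have -> : u1 - u3 = (u1 - u2) + (u2 - u3) by rewrite addrA subrK.
  by rewrite memv_add ?memv_line.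
(* When [O12 = O23], their join is that single point and not a line. Then [sO13] places [O13] inside
   it, and any line through the point works. *)
have [eO | /eqP nO] := eqVneq O12 O23; last exact: collinear_join.
have sO : (O13 <= O12)%VS by move: sO13; rewrite -eO /join addvv.
have [m [_ Om _]] := collinear_diag O12 O12.
by exists m; split; rewrite -?eO // (subv_trans sO).
Qed.
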